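(* Let $X$ be a nonempty compact metric space. Given any $\sigma$-compact family $\mathcal{F}\subseteq\mathcal{C}(X,X)$, there exists a continuous map $U_{\mathcal{F}}:\mathbb{N}^{\mathbb{N}}\to\mathbb{N}^{\mathbb{N}}$ such that every $T\in\mathcal{F}$ is a factor of $U_{\mathcal{F}}$.
   Context: $\mathcal{C}(X,X)$ is the space of continuous maps from $X$ to $X$ with the topology of uniform convergence. A family is $\sigma$-compact if it is a countable union of compact subsets of $\mathcal{C}(X,X)$. $\mathbb{N}^{\mathbb{N}}$ is the Baire space (product topology of discrete spaces). A continuous self-map $T:X\to X$ of a topological space is a factor of a continuous self-map $S:E\to E$ if there is a continuous map $\pi$ from $E$ onto $X$ with $T\pi=\pi S$. *)

(* Defs.v *)
From HB Require Import structures.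
From mathcomp Require Import all_boot all_order all_algebra.
From mathcomp Require Import all_classical all_reals all_analysis.

Set Implicit Arguments.
Unset Strict Implicit.
Unset Printing Implicit Defensive.

Local Open Scope classical_set_scope.

(* The topology on [nat] provided by the library is the discrete one. *)
Definition baire_space : Type := prod_topology (fun _ : nat => nat).

HB.instance Definition _ := Topological.on baire_space.
HB.instance Definition _ := Uniform.on baire_space.

(* Continuous maps, with the subspace topology inherited from the topology of
   uniform convergence on all maps. *)
Definition cts_uniform (X : topologicalType) (Y : uniformType) : Type :=
  continuousType X Y.

HB.instance Definition _ (X : topologicalType) (Y : uniformType) :=
  Topological.copy (cts_uniform X Y)
    (initial_topology (id : continuousType X Y -> {uniform X -> Y})).

Definition sigma_compact (T : topologicalType) (F : set T) : Prop :=
  exists K : nat -> set T,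
    (forall n, compact (K n)) /\ F = \bigcup_n K n.

Definition is_factor (X E : topologicalType)
    (T : continuousType X X) (S : continuousType E E) : Prop :=
  exists pi : E -> X,
    [/\ continuous pi, set_surj [set: E] [set: X] pi & T \o pi = pi \o S].

(* Main.v *)
Require Import Defs.
From HB Require Import structures.
From mathcomp Require Import all_boot all_order all_algebra.
From mathcomp Require Import all_classical all_reals all_analysis.

(** One self-map of the Baire space has every continuous self-map of [X] as a
    factor.  Take the translation [(k, x) |-> (k + 1, x)] of the product of [nat]
    and [X]: for a continuous [T], the map [(k, x) |-> T^k x] sends the
    translation to [T], it is continuous because [nat] is discrete, and it is
    onto because its restriction to [k = 0] is the projection to [X].  The
    counter [k] records how often [T] has to be applied, so the translation
    itself does not depend on [T].

    To work on the Baire space, read a sequence [a] as the pair formed by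
    [k := a 0] and the point of [X] coded by [a 1, a 2, ...].  The coding is a
    continuous surjection from the Baire space to [X]: map the Baire space onto
    the Cantor space coordinatewise, then apply the Alexandroff-Hausdorff theorem
    (lemma [baire_surj]).  The translation becomes [succ_head], and the continuity
    of the factor map is lemma [continuous_iter_locally_constant].  Lemma
    [factor_succ_head] assembles these facts. *)

Local Open Scope classical_set_scope.

(** * Continuity into products and from discrete data *)

Lemma continuous_prod_topology (E : topologicalType) (I : Type)
    (K : I -> topologicalType) (f : E -> prod_topology K) :
  (forall i, continuous (fun x => f x i)) -> continuous f.
Proof.
move=> cf x; apply/cvg_sup => i U [_ [[W oW <-] Wfx WU]].
apply: filterS WU _; apply: cf.
exact: open_nbhs_nbhs.
Qed.

Lemma continuous_discrete (D : discreteTopologicalType) (Y : topologicalType)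
    (f : D -> Y) : continuous f.
Proof.
move=> x U /nbhs_singleton Ufx.
by apply: filterS (discrete_set1 x) => _ ->.
Qed.

Lemma continuous_iter (Y : topologicalType) (T : Y -> Y) (k : nat) :
  continuous T -> continuous (iter k T).
Proof.
move=> cT; elim: k => [|k IHk] x; first exact: cvg_id.
exact: (continuous_comp (IHk x) (cT (iter k T x))).
Qed.

(** The number [n x] of iterations may vary with the point: being a continuous
    function to a discrete space, it is constant near each point. *)
Lemma continuous_iter_locally_constant (E Y : topologicalType) (T : Y -> Y)
    (n : E -> nat) (q : E -> Y) :
  continuous T -> continuous n -> continuous q ->
  continuous (fun x => iter (n x) T (q x)).
Proof.
move=> cT cn cq x.
have n_near : \forall y \near x, n y = n x by exact: (cn x _ (discrete_set1 _)).
apply: (@cvg_trans _ ((fun y => iter (n x) T (q y)) @ x)).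
  by apply: near_eq_cvg; apply: filterS n_near => y ->.
exact: (continuous_comp (cq x) (@continuous_iter Y T (n x) cT (q x))).
Qed.

(** * The Baire space *)

Lemma continuous_baire_coord (i : nat) :
  continuous (fun a : baire_space => a i).
Proof. exact: (@proj_continuous nat (fun=> nat) i). Qed.

Definition baire_tail (a : baire_space) : baire_space := fun i => a i.+1.

Lemma continuous_baire_tail : continuous baire_tail.
Proof.
by apply: continuous_prod_topology => i; exact: continuous_baire_coord.
Qed.

Definition succ_head (a : baire_space) : baire_space :=
  fun i => if i is 0 then (a 0).+1 else a i.

Lemma continuous_succ_head : continuous succ_head.
Proof.
apply: continuous_prod_topology => -[|i]; last exact: continuous_baire_coord.
move=> a; apply: (continuous_comp (continuous_baire_coord 0 a)).
exact: continuous_discrete.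
Qed.

Definition baire_to_cantor (a : baire_space) : cantor_space :=
  fun i => a i != 0.

Lemma continuous_baire_to_cantor : continuous baire_to_cantor.
Proof.
apply: continuous_prod_topology => i a.
pose nonzero (m : nat) : bool := m != 0.
exact: (continuous_comp (continuous_baire_coord i a)
  (@continuous_discrete _ _ nonzero _)).
Qed.

Lemma baire_to_cantor_surj (b : cantor_space) :
  exists a, baire_to_cantor a = b.
Proof.
by exists (fun i => nat_of_bool (b i)); apply: funext => i /=;
  rewrite /baire_to_cantor; case: (b i).
Qed.

(** * Coding a compact metric space, and the factor maps *)

Lemma baire_surj (R : realType) (X : metricType R) :
    [set: X] !=set0 -> compact [set: X] ->
  exists2 q : baire_space -> X, continuous q & forall x, exists a, q a = x.
Proof.
move=> [x0 _] X_compact.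
(* The Alexandroff-Hausdorff theorem is about pointed spaces. *)
pose pX := HB.pack_for (pseudoPMetricType R) (X : Type)
  (PseudoMetric.on X) (isPointed.Build X x0).
have [f cf] := @cantor_surj R pX X_compact (@metric_hausdorff R X).
exists (f \o baire_to_cantor) => [a|x].
  exact: (continuous_comp (@continuous_baire_to_cantor a) (cf _)).
have [b _ <-] := @surj _ _ _ _ f x I.
by have [a <-] := baire_to_cantor_surj b; exists a.
Qed.

(** The factor map is [a |-> T^(a 0) (q (a 1, a 2, ...))]: raising [a 0] by one
    applies [T] once more. *)
Lemma factor_succ_head (X : topologicalType) (q : baire_space -> X)
    (T : continuousType X X) :
    continuous q -> (forall x, exists a, q a = x) ->
  is_factor T (mkcts continuous_succ_head).
Proof.
move=> cq q_surj; exists (fun a => iter (a 0) T (q (baire_tail a))); split.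
- apply: continuous_iter_locally_constant.
  + exact: cts_fun.
  + exact: continuous_baire_coord.
  + by move=> a; exact: (continuous_comp (@continuous_baire_tail a) (cq _)).
- move=> x _; have [a <-] := q_surj x.
  (* With counter 0, the factor map is the coding itself. *)
  by exists (fun i => if i is j.+1 then a j else 0).
- by [].
Qed.

Theorem theorem4p7 (R : realType) (X : metricType R)
    (X_nonempty : [set: X] !=set0) (X_compact : compact [set: X])
    (F : set (cts_uniform X X)) (F_sigma_compact : sigma_compact F) :
  exists U : continuousType baire_space baire_space,
    forall T : cts_uniform X X, F T -> is_factor T U.
Proof.
have [q cq q_surj] := baire_surj R X X_nonempty X_compact.
exists (mkcts continuous_succ_head) => T _.
exact: (factor_succ_head X q T cq q_surj).
Qed.
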